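(* Let $n\ge 1$, let $\mu$ be a partition with at most $n$ parts (regarded as a weak composition with $n$ parts by appending zeros), and let $\alpha$ be a weak composition with $n$ parts. Then the product of Demazure atoms $\mathcal{A}_\mu\cdot\mathcal{A}_\alpha$ is atom-positive, i.e. there are nonnegative integers $c_\beta$ such that $\mathcal{A}_\mu\cdot\mathcal{A}_\alpha=\sum_{\beta}c_\beta\,\mathcal{A}_\beta$, the sum running over weak compositions $\beta$.
   Context: Let $P=\mathbb{Z}[x_1,x_2,\dots]$. For $i\ge1$ let $s_i$ act on $P$ by swapping $x_i$ and $x_{i+1}$, and define operators $\partial_i f=\frac{f-s_if}{x_i-x_{i+1}}$ and $\theta_i f=x_{i+1}\partial_i f$. For a permutation $w$ with reduced decomposition $w=s_{i_1}\cdots s_{i_l}$ put $\theta_w=\theta_{i_1}\cdots\theta_{i_l}$ (composition of operators; independent of the reduced word), with $\theta_{\mathrm{id}}$ the identity. For a weak composition $\gamma=(\gamma_1,\dots,\gamma_n)$ write $x^\gamma=x_1^{\gamma_1}\cdots x_n^{\gamma_n}$; $s_i$ acts on weak compositions by swapping the $i$-th and $(i+1)$-th entries. Let $\lambda$ be the partition obtained by sorting $\gamma$ into weakly decreasing order and let $w$ be the permutation of minimal length with $w\cdot\lambda=\gamma$ (where $s_{i_1}\cdots s_{i_l}\cdot\lambda$ means apply $s_{i_l}$ first). The Demazure atom is $\mathcal{A}_\gamma=\theta_w x^\lambda$. (For a partition $\mu$, $\mathcal{A}_\mu=x^\mu$.) The atoms form a basis of $P$ (over weak compositions of all lengths). 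*)

(* Defs.v *)
From HB Require Import structures.
From mathcomp Require Import all_boot all_order all_algebra all_fingroup.
From mathcomp Require Import mpoly.
From Stdlib Require Import ClassicalEpsilon.
Set Implicit Arguments. Unset Strict Implicit. Unset Printing Implicit Defensive.
Import GRing.Theory.
Local Open Scope ring_scope.

Section Atoms.
Variable n : nat.
Local Notation P := {mpoly int[n]}.

(* 0-based: index i swaps coordinates i and i+1 (i.e. x_{i+1}, x_{i+2} in the
   paper's 1-based numbering); only used for i.+1 < n. *)
Definition swapn (i j : nat) : nat :=
  if j == i then i.+1 else if j == i.+1 then i else j.
Definition si (i : nat) (j : 'I_n) : 'I_n := insubd j (swapn i j).

Definition swapc (i : nat) (m : 'X_{1..n}) : 'X_{1..n} :=
  [multinom m (si i j) | j < n].

(* the variable x_{j+1} (0-based index j < n) *)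
Definition varx (j : nat) : P := 'X_[[multinom ((k : nat) == j : nat) | k < n]].

Definition swapp (i : nat) (f : P) : P :=
  \sum_(m <- msupp f) f@_m *: 'X_[swapc i m].

(* divided difference: the (unique) q with (x_i - x_{i+1}) q = f - s_i f *)
Definition ddiff (i : nat) (f : P) : P :=
  epsilon (inhabits 0)
    (fun q : P => (varx i - varx i.+1) * q = f - swapp i f).

Definition theta (i : nat) (f : P) : P := varx i.+1 * ddiff i f.

Definition valid_word (w : seq nat) : bool := all (fun i => i.+1 < n)%N w.
Definition act_word (w : seq nat) (m : 'X_{1..n}) : 'X_{1..n} :=
  foldr swapc m w.
Definition theta_word (w : seq nat) (f : P) : P := foldr theta f w.

Definition sortc (g : 'X_{1..n}) : 'X_{1..n} :=
  [multinom nth 0%N (sort geq [seq g j | j <- enum 'I_n]) j | j < n].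

(* shortest words sending lambda to gamma: these are exactly the reduced
   words of the minimal-length w with w . lambda = gamma *)
Definition min_word (lam g : 'X_{1..n}) (w : seq nat) : Prop :=
  [/\ valid_word w, act_word w lam = g &
      forall w', valid_word w' -> act_word w' lam = g -> (size w <= size w')%N].

Definition atom (g : 'X_{1..n}) : P :=
  let lam := sortc g in
  theta_word (epsilon (inhabits [::]) (min_word lam g)) 'X_[lam].

End Atoms.

(* Main.v *)
(* It suffices to multiply an atom by x^e with e a decreasing 0/1 vector, as x^mu is a
   product of such monomials.  As x^e commutes with theta_i when e_i = e_(i+1), one
   writes A_alpha = theta_u A_beta with beta decreasing on the blocks of e, so that
   x^e A_alpha = theta_u (x^e A_beta).  The relation x_i theta_i = pi_i x_(i+1), where
   pi_i = 1 + theta_i, turns x^e A_beta into pi_v x^nu with nu a partition.  For a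
   reduced u, theta_u pi_i is 0 or theta_u + theta_(u s_i) with u s_i reduced, so
   x^e A_alpha is a sum of terms theta_w x^nu with w reduced, each 0 or an atom.
   Permutations are encoded by compositions with distinct entries, which makes reduced
   words and the exchange condition statements about ascents. *)
Require Import Defs.
From HB Require Import structures.
From mathcomp Require Import all_boot all_order all_algebra all_fingroup.
From mathcomp Require Import mpoly ring zify.
From Stdlib Require Import ClassicalEpsilon FunctionalExtensionality.
Import GRing.Theory.
Local Open Scope ring_scope.
Set Implicit Arguments. Unset Strict Implicit. Unset Printing Implicit Defensive.

(** * Operators of the form b (1 - s) / (a - b) over an integral domain *)

Section IsobaricOperators.
Variables (R : idomainType) (s t : {rmorphism R -> R}) (S T : R -> R).

(** After multiplication by (a - b)(c - d), both sides become b d (f - s f - t f + s (t f)). *)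
Lemma isobaric_comm (a b c d : R) :
    s c = c -> s d = d -> t a = a -> t b = b -> a - b != 0 -> c - d != 0 ->
    (forall f, s (t f) = t (s f)) ->
    (forall f, (a - b) * S f = b * (f - s f)) ->
    (forall f, (c - d) * T f = d * (f - t f)) ->
  forall f, S (T f) = T (S f).
Proof.
move=> sc sd ta tb nab ncd st HS HT f.
have E1 := HT f; have E2 := congr1 s E1; have E3 := HS f; have E4 := congr1 t E3.
move: E2 E4; rewrite !rmorphM !rmorphB ?sc ?sd ?ta ?tb /= -st => E2 E4.
apply: (mulfI (mulf_neq0 nab ncd)).
transitivity (b * ((c - d) * T f - (c - d) * s (T f))).
  by rewrite mulrAC HS; ring.
transitivity (d * ((a - b) * S f - (a - b) * t (S f))).
  by rewrite E1 E2 E3 E4; ring.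
by rewrite -mulrA HT; ring.
Qed.

(** Clearing denominators turns both sides into [b * c ^+ 2] times the signed sum of [f] over the
    six elements of the symmetric group on three letters. *)
Lemma isobaric_braid (a b c : R) :
    (forall f, s (s f) = f) -> (forall f, t (t f) = f) ->
    s a = b -> s b = a -> s c = c -> t a = a -> t b = c -> t c = b ->
    a - b != 0 -> b - c != 0 -> a - c != 0 ->
    (forall f, s (t (s f)) = t (s (t f))) ->
    (forall f, (a - b) * S f = b * (f - s f)) ->
    (forall f, (b - c) * T f = c * (f - t f)) ->
  forall f, S (T (S f)) = T (S (T f)).
Proof.
move=> ss tt sa sb sc ta tb tc nab nbc nac sts HS HT f.
have nD : (a - b) * (b - c) * (a - c) != 0 by rewrite !mulf_neq0.
apply: (mulfI nD).
transitivity (b * c ^+ 2 *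
    (f - s f - t f + t (s f) + s (t f) - s (t (s f)))).
  have E1 := HS f; have E2 := congr1 s E1; have E3 := congr1 t E1.
  have E4 := congr1 s E3; have E5 := HT (S f); have E6 := congr1 s E5.
  have E7 := HS (T (S f)).
  move: E2 E3 E4 E6.
  do !rewrite ?rmorphM ?rmorphB ?sa ?sb ?sc ?ta ?tb ?tc ?ss /=.
  move=> E2 E3 E4 E6.
  apply: (mulfI nab); apply/eqP; rewrite -subr_eq0.
  (* An explicit combination of the defining relations of [S] and [T] and of their images under [s]
     and [t]: each summand vanishes by one of [E1] to [E7]. *)
  rewrite (_ : _ - _ =
      (a - b) * (b - c) * (a - c) * ((a - b) * S (T (S f)) - b * (T (S f) - s (T (S f))))
    + b * (a - b) * (a - c) * ((b - c) * T (S f) - c * (S f - t (S f)))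
    - b * (a - b) * (b - c) * ((a - c) * s (T (S f)) - c * (s (S f) - s (t (S f))))
    + b * c * (a - c) * ((a - b) * S f - b * (f - s f))
    - b * c * (a - b) * ((a - c) * t (S f) - c * (t f - t (s f)))
    + b * c * (b - c) * ((b - a) * s (S f) - a * (s f - f))
    + b * c * (a - b) * ((b - c) * s (t (S f)) - c * (s (t f) - s (t (s f)))));
    last by ring.
  by rewrite E1 E2 E3 E4 E5 E6 E7 !subrr !mulr0 !(addr0, subr0).
have E1 := HT f; have E2 := congr1 t E1; have E3 := congr1 s E1.
have E4 := congr1 t E3; have E5 := HS (T f); have E6 := congr1 t E5.
have E7 := HT (S (T f)).
move: E2 E3 E4 E6.
do !rewrite ?rmorphM ?rmorphB ?sa ?sb ?sc ?ta ?tb ?tc ?tt /=.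
move=> E2 E3 E4 E6; rewrite sts.
apply: (mulfI nbc); apply/esym/eqP; rewrite -subr_eq0.
rewrite (_ : _ - _ =
    (a - b) * (b - c) * (a - c) * ((b - c) * T (S (T f)) - c * (S (T f) - t (S (T f))))
  + c * (b - c) * (a - c) * ((a - b) * S (T f) - b * (T f - s (T f)))
  - c * (a - b) * (b - c) * ((a - c) * t (S (T f)) - c * (t (T f) - t (s (T f))))
  + c * b * (a - c) * ((b - c) * T f - c * (f - t f))
  - c * b * (b - c) * ((a - c) * s (T f) - c * (s f - s (t f)))
  + c ^+ 2 * (a - b) * ((c - b) * t (T f) - b * (t f - f))
  + c ^+ 2 * (b - c) * ((a - b) * t (s (T f)) - b * (t (s f) - t (s (t f)))));
  last by ring.
by rewrite E1 E2 E3 E4 E5 E6 E7 !subrr !mulr0 !(addr0, subr0).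
Qed.

(** In the fraction field, [S f] is [b] times the [s]-invariant (f - s f) / (a - b), and S b =
    -b. *)
Lemma isobaric_idem (a b : R) :
    s a = b -> s b = a -> (forall f, s (s f) = f) -> a - b != 0 ->
    (forall f, (a - b) * S f = b * (f - s f)) ->
  forall f, S (S f) = - S f.
Proof.
move=> sa sb ss nab HS f; apply: (mulfI nab).
apply: (mulfI nab).
have E1 := HS f; have E2 := congr1 s E1.
move: E2; rewrite !rmorphM !rmorphB ?sa ?sb /= ss => E2.
transitivity (b * ((a - b) * S f + (b - a) * s (S f))).
  by rewrite HS; ring.
by rewrite E1 E2 mulrN E1; ring.
Qed.

(** This is x_i theta_i = pi_i x_(i+1), with an invariant factor [y] so that it applies to whole
    monomials. Multiplied by a - b, both sides become a b y (f - s f). *)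
Lemma isobaric_mul (a b y : R) :
    s b = a -> s y = y -> a - b != 0 ->
    (forall f, (a - b) * S f = b * (f - s f)) ->
  forall f, a * y * S f = b * y * f + S (b * y * f).
Proof.
move=> sb sy nab HS f; apply: (mulfI nab); rewrite mulrDr HS !rmorphM /= sb sy.
by rewrite mulrCA HS; ring.
Qed.

End IsobaricOperators.

(* The innermost tests are split first, as [if ... then ... else ...] is opaque to [lia]. *)
Ltac split_swapn :=
  rewrite /swapn;
  repeat match goal with |- context [@eq_op ?T ?x ?y] =>
    lazymatch x with context [if _ then _ else _] => fail | _ =>
    lazymatch y with context [if _ then _ else _] => fail | _ =>
      let e := fresh "e" in case e : (@eq_op T x y); rewrite /= end end
  end.

(** * Ascents of compositions and reduced words *)

Section Compositions.
Local Open Scope nat_scope.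
Variable n : nat.
Implicit Types (g h : 'X_{1..n}) (w : seq nat).

Lemma eq_mnm_nth g h : (forall j, j < n -> nth 0 g j = nth 0 h j) -> g = h.
Proof. by move=> gh; apply/mnmP => j; rewrite !(mnm_nth 0); apply: gh. Qed.

Lemma nth_multinom (F : 'I_n -> nat) j (ltjn : j < n) :
  nth 0 [multinom F i | i < n] j = F (Ordinal ltjn).
Proof. by rewrite -[j]/(val (Ordinal ltjn)) -mnm_nth mnmE. Qed.

Lemma mnm_enum g : [seq g j | j <- enum 'I_n] = g.
Proof. by rewrite -[RHS]map_tnth_enum. Qed.

Lemma ltn_swapn i j : i.+1 < n -> j < n -> swapn i j < n.
Proof. by move=> *; split_swapn; lia. Qed.

Lemma swapnK i : involutive (swapn i).
Proof. by move=> j; split_swapn; lia. Qed.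

Lemma swapn_l i : swapn i i = i.+1.
Proof. by rewrite /swapn eqxx. Qed.

Lemma swapn_r i : swapn i i.+1 = i.
Proof. by rewrite /swapn eqxx gtn_eqF. Qed.

Lemma swapn_lt i j : j < i -> swapn i j = j.
Proof. by move=> ji; rewrite /swapn !ltn_eqF //; lia. Qed.

Lemma swapn_gt i j : i.+1 < j -> swapn i j = j.
Proof. by move=> ij; rewrite /swapn !gtn_eqF //; lia. Qed.

Lemma nth_swapc i g j : i.+1 < n -> nth 0 (swapc i g) j = nth 0 g (swapn i j).
Proof.
move=> lti; have [ltj|lej] := ltnP j n.
  by rewrite nth_multinom (mnm_nth 0) val_insubd ltn_swapn.
rewrite !nth_default ?size_tuple //.
by split_swapn; lia.
Qed.

Lemma swapc_id i g : i.+1 < n -> nth 0 g i = nth 0 g i.+1 -> swapc i g = g.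
Proof.
move=> lti gi; apply: eq_mnm_nth => j _; rewrite nth_swapc // /swapn.
by case: eqP => [->//|_]; case: eqP => [->|].
Qed.

Lemma swapcK i g : i.+1 < n -> swapc i (swapc i g) = g.
Proof.
by move=> lti; apply: eq_mnm_nth => j _; rewrite !nth_swapc // swapnK.
Qed.

Lemma swapc_comm i j g : i.+1 < j -> j.+1 < n ->
  swapc i (swapc j g) = swapc j (swapc i g).
Proof.
move=> ij ltj; apply: eq_mnm_nth => k _; rewrite !nth_swapc; try lia.
by congr nth; split_swapn; lia.
Qed.

Lemma swapc_braid i g : i.+2 < n ->
  swapc i (swapc i.+1 (swapc i g)) = swapc i.+1 (swapc i (swapc i.+1 g)).
Proof.
move=> ltj; apply: eq_mnm_nth => k _; rewrite !nth_swapc; try lia.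
by congr nth; split_swapn; lia.
Qed.

Definition asc_set g : {set 'I_n * 'I_n} :=
  [set pq : 'I_n * 'I_n | (pq.1 < pq.2) && (nth 0 g pq.1 < nth 0 g pq.2)].

(** The length of the shortest permutation carrying [sortc g] to [g]; pairs of equal entries
    contribute nothing to it. *)
Definition nasc g : nat := #|asc_set g|.

(** Exchanging the positions i and i+1 matches the ascending pairs of [swapc i g] with those of [g]
    other than (i, i+1), the only pair of positions whose order it reverses. *)
Lemma nasc_swapc i g : i.+1 < n -> nth 0 g i < nth 0 g i.+1 ->
  nasc g = (nasc (swapc i g)).+1.
Proof.
move=> lti gi; pose f (pq : 'I_n * 'I_n) := (si i pq.1, si i pq.2).
have siE (p : 'I_n) : si i p = swapn i p :> nat.
  by rewrite /si val_insubd ltn_swapn.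
have fK : involutive f.
  by case=> p q; congr pair; apply: val_inj; rewrite /= !siE swapnK.
pose pq0 : 'I_n * 'I_n := (Ordinal (ltnW lti), Ordinal lti).
have mem_f (pq : 'I_n * 'I_n) : (pq \in f @: asc_set (swapc i g)) =
    (swapn i pq.1 < swapn i pq.2) && (nth 0 g pq.1 < nth 0 g pq.2).
  rewrite -{1}[pq]fK mem_imset; last exact: inv_inj.
  by rewrite inE /= !nth_swapc // !siE !swapnK.
rewrite /nasc (_ : asc_set g = pq0 |: f @: asc_set (swapc i g)); last first.
  apply/setP => -[p q]; rewrite in_setU1 mem_f inE /= xpair_eqE -!val_eqE /=.
  case: (ltnP (nth 0 g p) (nth 0 g q)) => gpq; rewrite ?andbF ?andbT ?orbF /=.
    have pq : (p != i.+1 :> nat) || (q != i :> nat).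
      by apply/negP => /negP; rewrite negb_or !negbK => /andP[/eqP pE /eqP qE];
         rewrite pE qE in gpq; lia.
    by move: pq; split_swapn; lia.
  by apply/esym/negP => /andP[/eqP pE /eqP qE]; rewrite pE qE in gpq; lia.
rewrite cardsU1 mem_f (card_imset _ (inv_inj fK)) /= /swapn !eqxx.
by rewrite (gtn_eqF (ltnSn i)) ltnNge leqnSn.
Qed.

Lemma nasc_swapc_le i g : i.+1 < n -> nasc g <= (nasc (swapc i g)).+1.
Proof.
move=> lti; have [lt|gt|eq] := ltngtP (nth 0 g i) (nth 0 g i.+1).
- by rewrite (nasc_swapc lti).
- rewrite (@nasc_swapc i (swapc i g)) ?swapcK //; first by lia.
  by rewrite !nth_swapc // /swapn !eqxx (gtn_eqF (ltnSn i)).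
- by rewrite swapc_id.
Qed.

Lemma nasc_swapc_lt i g : i.+1 < n -> nasc (swapc i g) < nasc g ->
  nth 0 g i < nth 0 g i.+1.
Proof.
move=> lti; have [lt|gt|eq] := ltngtP (nth 0 g i) (nth 0 g i.+1) => //.
- rewrite (@nasc_swapc i (swapc i g)) ?swapcK //; first by lia.
  by rewrite !nth_swapc // /swapn !eqxx (gtn_eqF (ltnSn i)).
- by rewrite swapc_id ?ltnn.
Qed.

Lemma mnm_sortedP g : reflect
  (forall p q, p < q -> q < n -> nth 0 g q <= nth 0 g p) (sorted geq g).
Proof.
have geq_trans : transitive geq by move=> x y z yx zy; apply: leq_trans yx.
apply: (iffP idP) => [sg p q pq qn|sg].
  apply: (sorted_ltn_nth geq_trans) => //; rewrite inE size_tuple //.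
  exact: ltn_trans qn.
by apply/(sortedP 0) => i; rewrite size_tuple => lti; apply: sg.
Qed.

Lemma ascent_or_sorted g :
  {i | i.+1 < n & nth 0 g i < nth 0 g i.+1} + sorted geq g.
Proof.
have [sg|nsg] := boolP (sorted geq g); first by right.
left; have [i] : {i : 'I_n | (i.+1 < n) && (nth 0 g i < nth 0 g i.+1)}.
  apply: sigW; apply/existsP; apply: contraNT nsg; rewrite negb_exists.
  move/forallP => sg; apply/(sortedP 0) => i; rewrite size_tuple => lti.
  by have := sg (Ordinal (ltnW lti)); rewrite /= lti -leqNgt.
by case/andP; exists i.
Qed.

Lemma nasc_sorted g : sorted geq g -> nasc g = 0.
Proof.
move/mnm_sortedP => sg; apply/eqP; rewrite cards_eq0; apply/eqP/setP => -[p q].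
by rewrite !inE /=; apply/negP => /andP[pq]; rewrite ltnNge sg.
Qed.

Lemma val_sortc g : sortc g = sort geq g :> seq nat.
Proof.
have sz : size (sort geq g) = n by rewrite size_sort size_tuple.
apply: (@eq_from_nth _ 0) => [|j]; rewrite ?sz size_tuple // => ltj.
by rewrite nth_multinom mnm_enum.
Qed.

Lemma sortc_sorted g : sorted geq (sortc g).
Proof. by rewrite val_sortc; apply: sort_sorted => x y; apply: leq_total. Qed.

Lemma sortc_id g : sorted geq g -> sortc g = g.
Proof.
move=> sg; apply/val_inj/val_inj; rewrite /= -[LHS]/(sortc g : seq nat).
by rewrite val_sortc sorted_sort // => x y z yx zy; apply: leq_trans yx.
Qed.

Lemma sortc_swapc i g : i.+1 < n -> sortc (swapc i g) = sortc g.
Proof.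
move=> lti; apply/val_inj/val_inj => /=.
rewrite -[LHS]/(sortc _ : seq nat) -[RHS]/(sortc _ : seq nat) !val_sortc.
apply/perm_sortP => [x y|x y z yx zy|x y|].
- exact: leq_total.
- exact: leq_trans yx.
- by rewrite andbC => /anti_leq.
have siK : injective (@si n i).
  apply: (can_inj (g := si i)) => p; apply: val_inj.
  by rewrite /si !val_insubd !ltn_swapn ?swapnK.
rewrite -(mnm_enum g) -(mnm_enum (swapc i g)).
rewrite (eq_map (g := g \o si i)) => [|j]; last by rewrite /= mnmE.
rewrite map_comp; apply: perm_map; apply: uniq_perm; rewrite ?enum_uniq //.
  by rewrite map_inj_uniq ?enum_uniq.
move=> j; rewrite mem_enum inE; apply/mapP; exists (si i j).
  by rewrite mem_enum.
by apply: val_inj; rewrite /si !val_insubd !ltn_swapn ?swapnK.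
Qed.

Definition reduced_word g w : Prop :=
  [/\ valid_word n w, act_word w (sortc g) = g & size w = nasc g].

Lemma nasc_act_word w g : valid_word n w -> nasc (act_word w g) <= size w + nasc g.
Proof.
elim: w => //= i w IH /andP[lti /IH{}IH].
by apply: leq_trans (nasc_swapc_le _ lti) _; rewrite swapcK.
Qed.

Lemma reduced_word_cons i g w : i.+1 < n -> nth 0 g i < nth 0 g i.+1 ->
  reduced_word (swapc i g) w -> reduced_word g (i :: w).
Proof.
move=> lti gi [vw aw sw]; split; rewrite /= ?lti //.
  by move: aw; rewrite sortc_swapc // => ->; rewrite swapcK.
by rewrite sw (nasc_swapc lti gi).
Qed.

(** The tail [w] reaches [swapc i g], so [nasc (swapc i g)] is at most [size w], which is less than
    [nasc g]; only an ascent at i lets the count drop. *)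
Lemma reduced_word_behead i g w : reduced_word g (i :: w) ->
  [/\ i.+1 < n, nth 0 g i < nth 0 g i.+1 & reduced_word (swapc i g) w].
Proof.
case=> /= /andP[lti vw] aw sw.
have aw' : act_word w (sortc g) = swapc i g by rewrite -{2}aw swapcK.
have le : nasc (swapc i g) <= size w.
  by rewrite -aw'; have := nasc_act_word (sortc g) vw;
     rewrite (nasc_sorted (sortc_sorted g)) addn0.
have gi : nth 0 g i < nth 0 g i.+1 by apply: nasc_swapc_lt => //; rewrite -sw.
split=> //; split; rewrite ?sortc_swapc //.
by have := nasc_swapc lti gi; lia.
Qed.

(** A swap at an ascent lowers [nasc] by one, so this plays the role of induction on the length of a
    permutation. *)
Lemma nasc_ind (Q : 'X_{1..n} -> Type) :
  (forall g, (forall i, i.+1 < n -> nth 0 g i < nth 0 g i.+1 -> Q (swapc i g)) ->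
    Q g) -> forall g, Q g.
Proof.
move=> IH g; have [m] := ubnP (nasc g); elim: m g => // m IHm g.
rewrite ltnS => le; apply: IH => i lti gi; apply: IHm.
by rewrite -(nasc_swapc lti gi).
Qed.

Lemma reduced_word_exists g : exists w, reduced_word g w.
Proof.
elim/nasc_ind: g => g IH; have [[i lti gi]|sg] := ascent_or_sorted g.
  by have [w rw] := IH i lti gi; exists (i :: w); apply: reduced_word_cons.
by exists [::]; split; rewrite //= ?sortc_id ?nasc_sorted.
Qed.

(** Some word has exactly [nasc g] letters, and no word has fewer. With [reduced_word_min], the
    shortest words are the reduced ones, so the word chosen in [atom] is reduced. *)
Lemma min_word_reduced g w : min_word (sortc g) g w -> reduced_word g w.
Proof.
case=> vw aw minw; split=> //; apply/eqP; rewrite eqn_leq.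
have [w' [vw' aw' sw']] := reduced_word_exists g; rewrite -{1}sw' minw //=.
have := nasc_act_word (sortc g) vw.
by rewrite aw (nasc_sorted (sortc_sorted g)) addn0.
Qed.

Lemma reduced_word_min g w : reduced_word g w -> min_word (sortc g) g w.
Proof.
case=> vw aw sw; split=> // w' vw' aw'; rewrite sw.
have := nasc_act_word (sortc g) vw'.
by rewrite aw' (nasc_sorted (sortc_sorted g)) addn0.
Qed.

End Compositions.

(** * Matsumoto's theorem for operators satisfying the braid relations *)

Section BraidRecursion.
Local Open Scope nat_scope.
Variable n : nat.
Variables (X : Type) (t : nat -> X -> X) (b : 'X_{1..n} -> X).
Implicit Types (g h : 'X_{1..n}) (w : seq nat).

Hypothesis t_comm : forall i j x, i.+1 < j -> j.+1 < n ->
  t i (t j x) = t j (t i x).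
Hypothesis t_braid : forall i x, i.+2 < n ->
  t i (t i.+1 (t i x)) = t i.+1 (t i (t i.+1 x)).

(** Abstract in the operators and the starting value, to cover both the action of theta on
    polynomials, where it unfolds to [atom], and right composition with theta. *)
Definition braid_rec g : X :=
  foldr t (b (sortc g)) (epsilon (inhabits [::]) (min_word (sortc g) g)).

(** If the first letters i and j differ, each word is compared by induction with a reduced word that
    goes on through the other letter to a common tail; a commutation or braid relation then joins
    the two. *)
Lemma foldr_reduced_word x g w1 w2 : reduced_word g w1 -> reduced_word g w2 ->
  foldr t x w1 = foldr t x w2.
Proof.
elim/nasc_ind: g w1 w2 => g IH [|i w1] [|j w2] r1 r2 //=.
- by have [_ _ s1] := r1; have [_ _ /=] := r2; rewrite -s1.
- by have [_ _ /= s1] := r1; have [_ _ /=] := r2; rewrite -s1.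
have [lti gi {}r1] := reduced_word_behead r1.
have [ltj gj {}r2] := reduced_word_behead r2.
wlog ij : i j w1 w2 lti gi r1 ltj gj r2 / i <= j.
  move=> W; case: (leqP i j) => [|/ltnW] ij; first exact: W.
  by apply/esym/W.
move: ij; rewrite leq_eqVlt => /orP[/eqP ij|].
  by subst j; congr (t i _); apply: (IH i).
rewrite leq_eqVlt => /orP[/eqP ij|ij].
  (* Ascents at i and i+1 make three consecutive entries strictly increasing, so i, i+1, i and i+1,
     i, i+1 both run along ascents to the same composition. *)
  subst j; have [u ru] := reduced_word_exists (swapc i (swapc i.+1 (swapc i g))).
  have ru' := ru; rewrite swapc_braid // in ru'.
  have lt02 := ltn_trans gi gj.
  have r1' : reduced_word (swapc i g) [:: i.+1, i & u].
    apply: reduced_word_cons; last apply: reduced_word_cons; rewrite ?nth_swapc //.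
      by rewrite swapn_r swapn_gt.
    by rewrite (@swapn_lt i.+1) // swapn_l swapn_l swapn_gt.
  have r2' : reduced_word (swapc i.+1 g) [:: i, i.+1 & u].
    apply: reduced_word_cons; last apply: reduced_word_cons; rewrite ?nth_swapc //.
      by rewrite swapn_lt // swapn_l.
    by rewrite (@swapn_gt i i.+2) // swapn_r swapn_r swapn_lt.
  rewrite (IH i lti gi _ _ r1 r1') (IH i.+1 ltj gj _ _ r2 r2') /=.
  exact: t_braid.
have [u ru] := reduced_word_exists (swapc i (swapc j g)).
have ru' := ru; rewrite swapc_comm // in ru'.
have r1' : reduced_word (swapc i g) (j :: u).
  by apply: reduced_word_cons; rewrite ?nth_swapc // !swapn_gt //; lia.
have r2' : reduced_word (swapc j g) (i :: u).
  by apply: reduced_word_cons; rewrite ?nth_swapc // !swapn_lt //; lia.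
rewrite (IH i lti gi _ _ r1 r1') (IH j ltj gj _ _ r2 r2') /=.
exact: t_comm.
Qed.

Lemma braid_recE g w : reduced_word g w -> braid_rec g = foldr t (b (sortc g)) w.
Proof.
move=> rw; apply: foldr_reduced_word rw; apply: min_word_reduced.
have [u /reduced_word_min ru] := reduced_word_exists g.
by apply: epsilon_spec; exists u.
Qed.

Lemma braid_rec_sorted g : sorted geq g -> braid_rec g = b g.
Proof.
move=> sg; rewrite (@braid_recE _ [::]) /= ?sortc_id //.
by split; rewrite //= ?sortc_id ?nasc_sorted.
Qed.

Lemma braid_rec_ascent i g : i.+1 < n -> nth 0 g i < nth 0 g i.+1 ->
  braid_rec g = t i (braid_rec (swapc i g)).
Proof.
move=> lti gi; have [w rw] := reduced_word_exists (swapc i g).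
rewrite (braid_recE rw) (braid_recE (reduced_word_cons lti gi rw)) /=.
by rewrite sortc_swapc.
Qed.

End BraidRecursion.

(** * The operators theta_i on polynomials *)

Section Theta.
Variable n : nat.
Local Notation P := {mpoly int[n]}.
Implicit Types (f g : P) (m : 'X_{1..n}).

Definition adjacent_tperm i (lti : (i.+1 < n)%N) : 'S_n :=
  tperm (Ordinal (ltnW lti)) (Ordinal lti).

Lemma adjacent_tpermE i (lti : (i.+1 < n)%N) (j : 'I_n) :
  adjacent_tperm lti j = swapn i j :> nat.
Proof.
rewrite /swapn; case: tpermP => [->|->|ji ji1] /=.
- by rewrite eqxx.
- by rewrite eqxx gtn_eqF.
case: eqP => [e|_]; first by case: ji; apply: val_inj.
by case: eqP => [e|_] //; case: ji1; apply: val_inj.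
Qed.

Lemma swappX i m : swapp i 'X_[m] = 'X_[swapc i m].
Proof. by rewrite /swapp msuppX big_seq1 mcoeffX eqxx scale1r. Qed.

(** Identification with [msym] supplies the ring morphism that the isobaric lemmas require. *)
Lemma swappE i (lti : (i.+1 < n)%N) f : swapp i f = msym (adjacent_tperm lti) f.
Proof.
rewrite [in RHS](mpolyE f) raddf_sum; apply: eq_bigr => m _.
rewrite /= msymZ msymX tpermV; congr (_ *: 'X_[_]).
apply: eq_mnm_nth => j ltj; rewrite nth_swapc // nth_multinom (mnm_nth 0%N).
by rewrite adjacent_tpermE.
Qed.

Lemma varxE (j : 'I_n) : varx n j = 'X_j.
Proof.
rewrite /varx; congr 'X_[_]; apply/mnmP => k.
by rewrite !mnmE eq_sym.
Qed.

Lemma swapp_varx i j : (i.+1 < n)%N -> (j < n)%N ->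
  swapp i (varx n j) = varx n (swapn i j).
Proof.
move=> lti ltj; rewrite swappX; congr 'X_[_].
apply: eq_mnm_nth => k ltk; rewrite nth_swapc // !nth_multinom ?ltn_swapn //.
by move=> ltk'; congr nat_of_bool; apply/eqP/eqP => /= [<-|->]; rewrite swapnK.
Qed.

Lemma swappK i : (i.+1 < n)%N -> involutive (@swapp n i).
Proof. by move=> lti f; rewrite !(swappE lti) -msymMm tperm2 msym1m. Qed.

Lemma swappD i : (i.+1 < n)%N -> {morph @swapp n i : f g / f + g}.
Proof. by move=> lti f g; rewrite !(swappE lti) rmorphD. Qed.

Lemma swappM i : (i.+1 < n)%N -> {morph @swapp n i : f g / f * g}.
Proof. by move=> lti f g; rewrite !(swappE lti) rmorphM. Qed.

Lemma swapp_comm i j f : (i.+1 < j)%N -> (j.+1 < n)%N ->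
  swapp i (swapp j f) = swapp j (swapp i f).
Proof.
move=> ij ltj; have lti : (i.+1 < n)%N by lia.
rewrite !(swappE lti) !(swappE ltj) -!msymMm; congr msym; apply/permP => k.
by apply: val_inj; rewrite !permM /= !adjacent_tpermE; split_swapn; lia.
Qed.

Lemma swapp_braid i f : (i.+2 < n)%N ->
  swapp i (swapp i.+1 (swapp i f)) = swapp i.+1 (swapp i (swapp i.+1 f)).
Proof.
move=> ltj; have lti : (i.+1 < n)%N by lia.
rewrite !(swappE lti) !(swappE ltj) -!msymMm; congr msym; apply/permP => k.
by apply: val_inj; rewrite !permM /= !adjacent_tpermE; split_swapn; lia.
Qed.

Lemma varx_neq i j : (i < j)%N -> (j < n)%N -> varx n i - varx n j != 0.
Proof.
move=> ij ltj; rewrite subr_eq0; apply/eqP => /(congr1 (mcoeff U_(Ordinal ltj))).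
rewrite -[i]/(val (Ordinal (ltn_trans ij ltj))) -[j in RHS]/(val (Ordinal ltj)).
by rewrite !varxE !mcoeffXU eqxx -val_eqE /= ltn_eqF.
Qed.

(** The polynomials with this property form a subring, by f g - s (f g) = (f - s f) g + (s f) (g - s
    g), and it contains the constants and the variables. *)
Lemma ddiff_exists i f : (i.+1 < n)%N ->
  exists q, (varx n i - varx n i.+1) * q = f - swapp i f.
Proof.
move=> lti; set d := varx n i - _.
pose Q f := exists q, d * q = f - swapp i f.
have Q0 c : Q c%:MP.
  exists 0; have -> : c%:MP = c *: 1 :> P by rewrite -mul_mpolyC mulr1.
  by rewrite (swappE lti) msymZ msym1 subrr mulr0.
have QD g h : Q g -> Q h -> Q (g + h).
  move=> [q dq] [r dr]; exists (q + r).
  by rewrite mulrDr dq dr swappD // opprD addrACA.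
have QM g h : Q g -> Q h -> Q (g * h).
  move=> [q dq] [r dr]; exists (q * h + swapp i g * r).
  by rewrite mulrDr mulrA dq mulrCA dr swappM //; ring.
have QX (j : 'I_n) : Q 'X_j.
  rewrite -varxE /Q swapp_varx // /swapn; case: eqP => [->|_].
    by exists 1; rewrite mulr1.
  case: eqP => [->|_]; first by exists (-1); rewrite mulrN1 opprB.
  by exists 0; rewrite mulr0 subrr.
rewrite (mpolyE f); apply: (big_ind Q) => //; first exact: (Q0 0).
move=> m _; rewrite -mul_mpolyC; apply: (QM) => //; rewrite mpolyXE_id.
apply: (big_ind Q) => // [|j _]; first exact: (Q0 1).
by elim: (m j) => [|k IH]; [exact: (Q0 1) | rewrite exprS; apply: QM].
Qed.

(** Removes the choice made in [ddiff]: as x_i - x_(i+1) can be cancelled, this equation determines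
    [theta i f]. *)
Lemma thetaE i f : (i.+1 < n)%N ->
  (varx n i - varx n i.+1) * theta i f = varx n i.+1 * (f - swapp i f).
Proof.
move=> lti; rewrite /theta mulrCA; congr (_ * _).
exact: epsilon_spec (ddiff_exists f lti).
Qed.

Lemma theta_comm i j f : (i.+1 < j)%N -> (j.+1 < n)%N ->
  theta i (theta j f) = theta j (theta i f).
Proof.
move=> ij ltj; have lti : (i.+1 < n)%N by lia.
have := swappE ltj; have := swappE lti.
move: (adjacent_tperm lti) (adjacent_tperm ltj) => si sj swE swE'.
apply: (@isobaric_comm P (msym si) (msym sj)
  (theta i) (theta j) (varx n i) (varx n i.+1) (varx n j) (varx n j.+1)).
- by rewrite /= -swE swapp_varx ?swapn_gt //; lia.
- by rewrite /= -swE swapp_varx ?swapn_gt //; lia.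
- by rewrite /= -swE' swapp_varx ?swapn_lt //; lia.
- by rewrite /= -swE' swapp_varx ?swapn_lt //; lia.
- exact: varx_neq.
- exact: varx_neq.
- by move=> g; rewrite /= -!swE -!swE' swapp_comm.
- by move=> g; rewrite /= -swE thetaE.
- by move=> g; rewrite /= -swE' thetaE.
Qed.

Lemma theta_braid i f : (i.+2 < n)%N ->
  theta i (theta i.+1 (theta i f)) = theta i.+1 (theta i (theta i.+1 f)).
Proof.
move=> ltj; have lti : (i.+1 < n)%N by lia.
have lt0 : (i < n)%N by lia.
have := swappE ltj; have := swappE lti.
move: (adjacent_tperm lti) (adjacent_tperm ltj) => si sj swE swE'.
apply: (@isobaric_braid P (msym si) (msym sj)
  (theta i) (theta i.+1) (varx n i) (varx n i.+1) (varx n i.+2)).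
- by move=> g; rewrite /= -!swE swappK.
- by move=> g; rewrite /= -!swE' swappK.
- by rewrite /= -swE swapp_varx // swapn_l.
- by rewrite /= -swE swapp_varx // swapn_r.
- by rewrite /= -swE swapp_varx // swapn_gt.
- by rewrite /= -swE' swapp_varx // swapn_lt.
- by rewrite /= -swE' swapp_varx // swapn_l.
- by rewrite /= -swE' swapp_varx // swapn_r.
- exact: varx_neq.
- exact: varx_neq.
- exact: varx_neq.
- by move=> g; rewrite /= -(swE g) -(swE' g) -(swE' (swapp i g)) -(swE (swapp i.+1 g))
    -(swE (swapp i.+1 (swapp i g))) -(swE' (swapp i (swapp i.+1 g))) swapp_braid.
- by move=> g; rewrite /= -swE thetaE.
- by move=> g; rewrite /= -swE' thetaE.
Qed.

Lemma theta_idem i f : (i.+1 < n)%N -> theta i (theta i f) = - theta i f.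
Proof.
move=> lti; have lt0 : (i < n)%N by lia.
have := swappE lti; move: (adjacent_tperm lti) => si swE.
apply: (@isobaric_idem P (msym si) (theta i)
  (varx n i) (varx n i.+1)).
- by rewrite /= -swE swapp_varx // swapn_l.
- by rewrite /= -swE swapp_varx // swapn_r.
- by move=> g; rewrite /= -!swE swappK.
- exact: varx_neq.
- by move=> g; rewrite /= -swE thetaE.
Qed.

Lemma thetaD i f g : (i.+1 < n)%N -> theta i (f + g) = theta i f + theta i g.
Proof.
move=> lti; apply: (mulfI (varx_neq (ltnSn i) lti)).
by rewrite mulrDr !thetaE // swappD // -mulrDr opprD addrACA.
Qed.

Lemma theta_fixed i f : (i.+1 < n)%N -> swapp i f = f -> theta i f = 0.
Proof.
move=> lti sf; apply: (mulfI (varx_neq (ltnSn i) lti)).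
by rewrite thetaE // sf subrr !mulr0.
Qed.

Lemma theta0 i : (i.+1 < n)%N -> @theta n i 0 = 0.
Proof. by move=> lti; apply: theta_fixed => //; rewrite (swappE lti) raddf0. Qed.

Lemma theta_mul_fixed i f g : (i.+1 < n)%N -> swapp i f = f ->
  theta i (f * g) = f * theta i g.
Proof.
move=> lti sf; apply: (mulfI (varx_neq (ltnSn i) lti)).
by rewrite thetaE // mulrCA thetaE // swappM // sf -mulrBr mulrCA.
Qed.

(** Here x^e is x_i times x^[e0], where [e0] vanishes at both i and i+1, so that its monomial is
    fixed by s_i and [isobaric_mul] applies. *)
Lemma mulX_theta i (e : 'X_{1..n}) f :
    (i.+1 < n)%N -> nth 0%N e i = 1%N -> nth 0%N e i.+1 = 0%N ->
  'X_[e] * theta i f = 'X_[swapc i e] * f + theta i ('X_[swapc i e] * f).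
Proof.
move=> lti ei ei1; pose e0 : 'X_{1..n} :=
  [multinom (if k == i :> nat then 0%N else e k) | k < n].
have se0 : swapp i 'X_[e0] = 'X_[e0] :> P.
  rewrite swappX swapc_id // !nth_multinom ?(ltnW lti) // => lti'.
  by rewrite /= eqxx gtn_eqF // (mnm_nth 0%N) /= ei1.
have eE : 'X_[e] = varx n i * 'X_[e0] :> P.
  rewrite -mpolyXD; congr 'X_[_]; apply/mnmP => k; rewrite !mnmE.
  by case: eqP => //= ki; rewrite (mnm_nth 0%N) ki ei.
have eE' : 'X_[swapc i e] = varx n i.+1 * 'X_[e0] :> P.
  by rewrite -swappX eE swappM // se0 swapp_varx ?swapn_l // ltnW.
rewrite eE eE'; have := swappE lti; move: (adjacent_tperm lti) => si swE.
apply: (@isobaric_mul P (msym si) (theta i)).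
- by rewrite /= -swE swapp_varx // swapn_r.
- by rewrite /= -swE.
- exact: varx_neq.
- by move=> g; rewrite /= -swE thetaE.
Qed.

End Theta.

(** * Atoms, and positivity of their products with dominant monomials *)

Section AtomPositivity.
Variable n : nat.
Local Notation P := {mpoly int[n]}.
Implicit Types (f : P) (e g h mu : 'X_{1..n}).

Lemma atom_sorted g : sorted geq g -> atom g = 'X_[g].
Proof.
apply: (@braid_rec_sorted _ _ (@theta n) (fun m => 'X_[m])) => *.
- exact: theta_comm.
- exact: theta_braid.
Qed.

Lemma atom_ascent i g : (i.+1 < n)%N -> (nth 0%N g i < nth 0%N g i.+1)%N ->
  atom g = theta i (atom (swapc i g)).
Proof.
apply: (@braid_rec_ascent _ _ (@theta n) (fun m => 'X_[m])) => *.
- exact: theta_comm.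
- exact: theta_braid.
Qed.

(** If A_g = theta_w x^lambda, then s_i w = w s_k for some s_k fixing lambda, and theta_k kills
    x^lambda. The induction moves theta_i inward along the ascents of [g]. *)
Lemma theta_atom_eq0 i g : (i.+1 < n)%N -> nth 0%N g i = nth 0%N g i.+1 ->
  theta i (atom g) = 0.
Proof.
have [m] := ubnP (nasc g); elim: m g i => // m IH g i; rewrite ltnS => le lti gi.
have [[j ltj gj]|sg] := ascent_or_sorted g; last first.
  by rewrite atom_sorted // theta_fixed // swappX swapc_id.
have nj := nasc_swapc ltj gj; rewrite (atom_ascent ltj gj).
have [ij|ji|eij] := ltngtP i j; last by rewrite -eij gi ltnn in gj.
- move: ij; rewrite leq_eqVlt => /orP[/eqP ij|ij]; last first.
    rewrite theta_comm // IH ?theta0 //; first by lia.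
    by rewrite !nth_swapc // !swapn_lt //; lia.
  subst j.
  (* Locally (a, a, c) becomes (a, c, a), then (c, a, a); the braid relation brings theta_(i+1) onto
     the equal pair. *)
  have asc : (nth 0%N (swapc i.+1 g) i < nth 0%N (swapc i.+1 g) i.+1)%N.
    by rewrite !nth_swapc // swapn_lt // swapn_l gi.
  have ni := nasc_swapc lti asc; rewrite (atom_ascent lti asc).
  rewrite theta_braid // (IH _ i.+1) ?theta0 //; first by lia.
  by rewrite !nth_swapc // swapn_r swapn_lt // (@swapn_gt i) // swapn_r.
move: ji; rewrite leq_eqVlt => /orP[/eqP ji|ji]; last first.
  rewrite -theta_comm // IH ?theta0 //; first by lia.
  by rewrite !nth_swapc // !swapn_gt //; lia.
subst i.
(* Mirror case: (a, c, c) becomes (c, a, c), then (c, c, a), with the equal pair at j. *)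
have asc : (nth 0%N (swapc j g) j.+1 < nth 0%N (swapc j g) j.+2)%N.
  by rewrite !nth_swapc // swapn_r swapn_gt // -gi.
have ni := nasc_swapc lti asc; rewrite (atom_ascent lti asc).
rewrite -theta_braid // (IH _ j) ?theta0 //; first by lia.
by rewrite !nth_swapc // (@swapn_lt j.+1) // !swapn_l swapn_gt.
Qed.

(** Letting theta_i act on operators by right composition allows [braid_rec] to add letters at the
    right end. *)
Definition precomp_theta i (F : P -> P) : P -> P := fun f => F (theta i f).

Lemma precomp_theta_comm i j F : (i.+1 < j)%N -> (j.+1 < n)%N ->
  precomp_theta i (precomp_theta j F) = precomp_theta j (precomp_theta i F).
Proof.
move=> ij ltj; apply: functional_extensionality => f.
by rewrite /precomp_theta -theta_comm.
Qed.

Lemma precomp_theta_braid i F : (i.+2 < n)%N ->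
  precomp_theta i (precomp_theta i.+1 (precomp_theta i F)) =
  precomp_theta i.+1 (precomp_theta i (precomp_theta i.+1 F)).
Proof.
move=> lti; apply: functional_extensionality => f.
by rewrite /precomp_theta theta_braid.
Qed.

(* [rtheta h] is theta_u for a reduced word u whose last letter, the first to act, is an
   ascent of [h]: the recursion is on the right, whereas that of [atom] is on the left. *)
Definition rtheta : 'X_{1..n} -> P -> P := braid_rec precomp_theta (fun=> id).

Lemma rtheta_sorted h f : sorted geq h -> rtheta h f = f.
Proof.
move=> sh; rewrite /rtheta.
by rewrite (braid_rec_sorted _ precomp_theta_comm precomp_theta_braid sh).
Qed.

Lemma rtheta_ascent i h f : (i.+1 < n)%N -> (nth 0%N h i < nth 0%N h i.+1)%N ->
  rtheta h f = rtheta (swapc i h) (theta i f).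
Proof.
move=> lti hi; rewrite /rtheta.
by rewrite (braid_rec_ascent _ precomp_theta_comm precomp_theta_braid lti hi).
Qed.

Lemma rthetaD h : {morph rtheta h : f g / f + g}.
Proof.
elim/nasc_ind: h => h IH f g; have [[i lti hi]|sh] := ascent_or_sorted h.
  by rewrite !(rtheta_ascent _ lti hi) thetaD // (IH i).
by rewrite !rtheta_sorted.
Qed.

Lemma rtheta0 h : rtheta h 0 = 0.
Proof. by apply: (addrI (rtheta h 0)); rewrite -rthetaD !addr0. Qed.

(** Nonnegative coefficients are encoded as multiplicities in a list, so that addition is
    concatenation. *)
Definition atom_positive f := exists s : seq 'X_{1..n}, f = \sum_(b <- s) atom b.

Lemma atom_positive0 : atom_positive 0.
Proof. by exists [::]; rewrite big_nil. Qed.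

Lemma atom_positive_atom g : atom_positive (atom g).
Proof. by exists [:: g]; rewrite big_seq1. Qed.

Lemma atom_positiveD f1 f2 :
  atom_positive f1 -> atom_positive f2 -> atom_positive (f1 + f2).
Proof. by move=> [s1 ->] [s2 ->]; exists (s1 ++ s2); rewrite big_cat. Qed.

(** Carries conditions on all pairs p < q across a swap, leaving only (i, i+1) to be checked
    separately. *)
Lemma swapn_homo i p q : (p < q)%N -> (p, q) != (i, i.+1) ->
  (swapn i p < swapn i q)%N.
Proof. by rewrite xpair_eqE; split_swapn; lia. Qed.

(* The hypothesis says that acting on [g] by the reduced word of [h] only creates
   ascents, so that no [theta_i] meets an atom already in its image. *)
Lemma rtheta_atom g h :
    (forall p q, (p < q < n)%N -> (nth 0%N g p < nth 0%N g q)%N -> (nth 0%N h q < nth 0%N h p)%N) ->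
  atom_positive (rtheta h (atom g)).
Proof.
elim/nasc_ind: h g => h IH g gh; have [[i lti hi]|sh] := ascent_or_sorted h.
  rewrite (rtheta_ascent _ lti hi).
  (* An ascent of [g] would contradict that of [h]; a descent makes theta_i A_g the atom of
     [swapc i g]; equal entries give zero. *)
  have [lt|gt|eq] := ltngtP (nth 0%N g i) (nth 0%N g i.+1).
  - by have := gh i i.+1; rewrite ltnSn lti lt => /(_ isT isT); lia.
  - rewrite -[g in atom g](swapcK g lti) -atom_ascent ?nth_swapc ?swapn_l ?swapn_r //.
    apply: (IH i) => // p q /andP[pq qn]; rewrite !nth_swapc //.
    have [[-> ->]|npq] := altP ((p, q) =P (i, i.+1)).
      by rewrite swapn_l swapn_r.
    by apply: gh; rewrite swapn_homo // ltn_swapn.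
  - by rewrite theta_atom_eq0 // rtheta0; apply: atom_positive0.
by rewrite rtheta_sorted //; apply: atom_positive_atom.
Qed.

(** Ends the next induction: for sorted [g], x^e A_g is a monomial whose exponent is then a
    partition. Pairs with e_p > e_q are settled by the sortedness of [g]. *)
Lemma sorted_addm e g : (forall j, nth 0%N e j <= 1)%N -> sorted geq g ->
    (forall p q, (p < q < n)%N -> (nth 0%N e p <= nth 0%N e q)%N ->
      (nth 0%N g q + nth 0%N e q <= nth 0%N g p + nth 0%N e p)%N) ->
  sorted geq (e + g)%MM.
Proof.
move=> e1 sg eg; apply/mnm_sortedP => p q pq qn; have pn := ltn_trans pq qn.
rewrite !nth_multinom !(mnm_nth 0%N) /=.
have [le|lt] := leqP (nth 0%N e p) (nth 0%N e q).
  by have := eg p q; rewrite pq qn => /(_ isT le); lia.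
by have /mnm_sortedP/(_ p q pq qn) := sg; lia.
Qed.

(* [e] is the indicator of the set of variables that have been multiplied in.  At
   an ascent of [g], the relation x_i theta_i = (1 + theta_i) x_{i+1} moves this set
   along, and composing 1 + theta_i with a reduced theta_h yields either 0 or the sum
   of two reduced ones. *)
Lemma rtheta_mulX_atom e g h :
    (forall j, nth 0%N e j <= 1)%N ->
    (forall p q, (p < q < n)%N -> nth 0%N h p != nth 0%N h q) ->
    (forall p q, (p < q < n)%N -> (nth 0%N e p <= nth 0%N e q)%N ->
      (nth 0%N g q + nth 0%N e q <= nth 0%N g p + nth 0%N e p)%N) ->
  atom_positive (rtheta h ('X_[e] * atom g)).
Proof.
elim/nasc_ind: g e h => g IH e h e1 h_inj eg.
have [[i lti gi]|sg] := ascent_or_sorted g; last first.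
  have seg := sorted_addm e1 sg eg.
  rewrite atom_sorted // -mpolyXD -atom_sorted //; apply: rtheta_atom => p q.
  by case/andP=> pq qn; rewrite ltnNge (elimT (mnm_sortedP _) seg).
(* If e_i <= e_(i+1), then [eg] would give g_(i+1) <= g_i, against the ascent. *)
have [ei ei1] : nth 0%N e i = 1%N /\ nth 0%N e i.+1 = 0%N.
  have := eg i i.+1; rewrite ltnSn lti => /(_ isT).
  by have := e1 i; have := e1 i.+1; lia.
rewrite (atom_ascent lti gi) mulX_theta //; set f := _ * _.
have pos (k : 'X_{1..n}) : (forall p q, (p < q < n)%N -> nth 0%N k p != nth 0%N k q) ->
    atom_positive (rtheta k f).
  move=> k_inj; apply: (IH i) => // [j|p q /andP[pq qn]]; rewrite !nth_swapc //.
  have [[-> ->]|npq] := altP ((p, q) =P (i, i.+1)).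
    (* At this pair the condition reads g_i + 1 <= g_(i+1): the strict ascent pays for the variable
       that has moved. *)
    by rewrite swapn_l swapn_r; lia.
  by apply: eg; rewrite swapn_homo // ltn_swapn.
(* At an ascent of [h], theta_i can be taken to act first in [rtheta h], and theta_i (1 + theta_i) =
   0. At a descent, [rtheta h] after theta_i is [rtheta (swapc i h)]. Distinct entries exclude
   equality. *)
have [lt|gt|eq] := ltngtP (nth 0%N h i) (nth 0%N h i.+1).
- rewrite (rtheta_ascent _ lti lt) thetaD // theta_idem // subrr rtheta0.
  exact: atom_positive0.
- rewrite rthetaD; apply: atom_positiveD; first exact: pos.
  rewrite -{1}[h](swapcK h lti) -rtheta_ascent ?nth_swapc ?swapn_l ?swapn_r //.
  apply: pos => p q /andP[pq qn]; rewrite !nth_swapc //.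
  have [[-> ->]|npq] := altP ((p, q) =P (i, i.+1)).
    by rewrite swapn_l swapn_r; lia.
  by apply: h_inj; rewrite swapn_homo // ltn_swapn.
- by have := h_inj i i.+1; rewrite ltnSn lti eq eqxx => /(_ isT).
Qed.

(** An ascent of [g] inside a block of equal entries of [e] yields a theta_i that commutes with x^e
    and is absorbed into [rtheta], as [h] descends there. When none is left, [g] is weakly
    decreasing on each block, as [rtheta_mulX_atom] demands. *)
Lemma rtheta_mulX_sorted_atom e g h :
    (forall j, nth 0%N e j <= 1)%N -> sorted geq e ->
    (forall p q, (p < q < n)%N -> nth 0%N h p != nth 0%N h q) ->
    (forall p q, (p < q < n)%N -> (nth 0%N g p < nth 0%N g q)%N ->
      (nth 0%N h q < nth 0%N h p)%N) ->
  atom_positive (rtheta h ('X_[e] * atom g)).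
Proof.
move=> e1 se; elim/nasc_ind: g h => g IH h h_inj gh.
have [/existsP[i]|] := boolP [exists i : 'I_n,
    [&& i.+1 < n, nth 0%N g i < nth 0%N g i.+1 & nth 0%N e i == nth 0%N e i.+1]%N].
  case/and3P => lti gi /eqP ei.
  have hi : (nth 0%N h i.+1 < nth 0%N h i)%N by apply: gh; rewrite // ltnSn.
  rewrite (atom_ascent lti gi) -theta_mul_fixed //; last first.
    by rewrite swappX swapc_id.
  rewrite -[h](swapcK h lti) -rtheta_ascent ?nth_swapc ?swapn_l ?swapn_r //.
  apply: (IH i) => // p q /andP[pq qn]; rewrite !nth_swapc //.
    have [[-> ->]|npq] := altP ((p, q) =P (i : nat, i.+1)).
      by rewrite swapn_l swapn_r; lia.
    by apply: h_inj; rewrite swapn_homo // ltn_swapn.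
  have [[-> ->]|npq] := altP ((p, q) =P (i : nat, i.+1)).
    by rewrite swapn_l swapn_r => lt; have := ltn_trans lt gi; rewrite ltnn.
  by apply: gh; rewrite swapn_homo // ltn_swapn.
rewrite negb_exists => /forallP noasc; apply: rtheta_mulX_atom => // p q /andP[pq qn].
move: se => /mnm_sortedP se lepq.
have epq : nth 0%N e q = nth 0%N e p.
  by apply/eqP; rewrite eqn_leq lepq se.
(* Since [e] is constant from p to q, the absence of ascents there chains to g_q <= g_p. *)
rewrite epq leq_add2r; elim: q pq qn epq {lepq} => // q IHq.
rewrite ltnS leq_eqVlt => /orP[/eqP <-|pq] qn epq.
  have := noasc (Ordinal (ltnW qn)).
  by rewrite /= qn epq eqxx andbT -leqNgt.
have epq' : nth 0%N e q = nth 0%N e p.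
  apply/eqP; rewrite eqn_leq se //= -?epq ?se //; exact: ltnW.
apply: leq_trans (IHq pq (ltnW qn) epq').
by have := noasc (Ordinal (ltnW qn)); rewrite /= qn epq epq' eqxx andbT -leqNgt.
Qed.

Lemma atom_positive_mulX e f : (forall j, nth 0%N e j <= 1)%N -> sorted geq e ->
  atom_positive f -> atom_positive ('X_[e] * f).
Proof.
move=> e1 se [s ->]; rewrite mulr_sumr.
apply: (big_ind atom_positive) => [||g _]; first exact: atom_positive0.
  exact: atom_positiveD.
(* The entries n, n-1, ..., 1 encode the identity permutation: [rtheta d] changes nothing, and
   strict decrease meets both conditions on [h]. *)
pose d : 'X_{1..n} := [multinom (n - j)%N | j < n].
have sd : sorted geq d.
  apply/mnm_sortedP => p q pq qn; rewrite !nth_multinom ?(ltn_trans pq qn) //=.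
  by move=> *; lia.
rewrite -[_ * _](rtheta_sorted _ sd); apply: rtheta_mulX_sorted_atom => // p q.
  case/andP => pq qn; rewrite !nth_multinom ?(ltn_trans pq qn) //= => *.
  by apply/eqP; lia.
case/andP => pq qn _; rewrite !nth_multinom ?(ltn_trans pq qn) //= => *.
by lia.
Qed.

Lemma atom_positive_mulX_sorted mu f : sorted geq mu ->
  atom_positive f -> atom_positive ('X_[mu] * f).
Proof.
have [m] := ubnP (mdeg mu); elim: m mu => // m IH mu; rewrite ltnS => le smu posf.
have [->|mu0] := eqVneq mu 0%MM; first by rewrite mpolyX0 mul1r.
(* The first column of the diagram of [mu]: a decreasing 0/1 vector whose removal leaves a partition
   of smaller degree. *)
pose e : 'X_{1..n} := [multinom (0 < mu j : nat)%N | j < n].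
have muE : mu = (e + (mu - e))%MM.
  by apply/mnmP => j; rewrite !mnmE; case: (mu j) => //= k; rewrite subn1 add1n.
have e0 : (0 < mdeg e)%N.
  rewrite lt0n mdeg_eq0; apply: contra mu0 => /eqP e0; apply/eqP/mnmP => j.
  by have := congr1 (fun k : 'X_{1..n} => k j) e0; rewrite !mnmE; case: (mu j).
rewrite muE mpolyXD -mulrA; apply: atom_positive_mulX.
- move=> j; have [ltj|lej] := ltnP j n; last by rewrite nth_default ?size_tuple.
  by rewrite nth_multinom leq_b1.
- apply/mnm_sortedP => p q pq qn; rewrite !nth_multinom ?(ltn_trans pq qn) // => pn.
  rewrite !(mnm_nth 0%N) /=.
  by have /mnm_sortedP/(_ p q pq qn) := smu; lia.
apply: IH => //; first by rewrite [X in mdeg X]muE mdegD in le; lia.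
apply/mnm_sortedP => p q pq qn; rewrite !nth_multinom ?(ltn_trans pq qn) // => pn.
rewrite !mnmE !(mnm_nth 0%N) /=.
by have /mnm_sortedP/(_ p q pq qn) := smu; lia.
Qed.

End AtomPositivity.

Theorem theorem4p1 (n : nat) (hn : (0 < n)%N) (mu alpha : 'X_{1..n})
    (hmu : sorted geq [seq mu j | j <- enum 'I_n]) :
  exists (bs : seq 'X_{1..n}) (c : 'X_{1..n} -> nat),
    atom mu * atom alpha = \sum_(b <- undup bs) (c b)%:R *: atom b.
Proof.
rewrite mnm_enum in hmu; rewrite (atom_sorted hmu).
have [s ->] := atom_positive_mulX_sorted hmu (atom_positive_atom alpha).
(* The coefficient of each atom is its multiplicity in [s]. *)
exists s, (fun b => count_mem b s); rewrite -big_undup_iterop_count.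
by apply: eq_bigr => b _; rewrite scaler_nat.
Qed.
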